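(* Let $N\ge1$, $d\ge2$, let $\bm{p}=(p_1,\ldots,p_d)$ be a probability distribution with all $p_j>0$, and let $\bm{u}=\{u^{(j)}\}_{j=0}^{d-1}$ be real functions on $\{1,\ldots,d\}$ with $\sum_{i=1}^d u^{(l)}_iu^{(m)}_ip_i=a_l\delta_{lm}$, $a_l>0$, such that $u^{(0)}_i=1$ for $i=1,\ldots,d$ and $u^{(j)}_1=1$ for $j=0,\ldots,d-1$. For $\bm{n}^+=(n_0,\ldots,n_{d-1})\in\mathbb{Z}_{\ge0}^d$ with $|\bm{n}^+|=N$ define $\kappa_l=\sum_{j=0}^{d-1}u_l^{(j)}n_j$, $l=2,\ldots,d$. Then for each fixed $\bm{x}\in\mathbb{Z}_{\ge0}^d$ with $|\bm{x}|=N$, as a function of $\bm{n}^+$, $$\binom{N}{\bm{n}^+}^{-1}Q_{\bm{n}}(\bm{x};\bm{u})$$ is a polynomial of total degree $\sum_{i=2}^dx_i$ in $\{\kappa_l\}_{l=2}^d$ whose only term of maximal degree is, up to a nonzero constant factor, $\prod_{l=2}^d\kappa_l^{x_l}$. That is, there are a polynomial $P\in\mathbb{R}[y_2,\ldots,y_d]$ and a constant $c\neq0$ (depending on $N,\bm{x},\bm{u}$ but not on $\bm{n}^+$) such that the displayed quantity equals $P(\kappa_2,\ldots,\kappa_d)$ for all such $\bm{n}^+$, and every monomial of $P-c\prod_{l=2}^dy_l^{x_l}$ has total degree strictly less than $\sum_{i=2}^dx_i$.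
   Context: $|\cdot|$ denotes the sum of entries of a vector. For $\bm{n}=(n_1,\ldots,n_{d-1})$ with $|\bm{n}|\le N$, $\bm{n}^+=(n_0,n_1,\ldots,n_{d-1})$ with $n_0=N-|\bm{n}|$, and $\binom{N}{\bm{n}^+}=N!/\prod_{j=0}^{d-1}n_j!$. The multivariate Krawtchouk polynomial $Q_{\bm{n}}(\bm{x};\bm{u})$ is the coefficient of $w_1^{n_1}\cdots w_{d-1}^{n_{d-1}}$ in $$\prod_{j=1}^d\Big(1+\sum_{l=1}^{d-1}w_lu_j^{(l)}\Big)^{x_j}.$$ *)

(* Defs.v *)
From mathcomp Require Import all_boot all_order all_algebra.
From mathcomp Require Import mpoly.
Set Implicit Arguments.
Unset Strict Implicit.
Unset Printing Implicit Defensive.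
Import GRing.Theory Num.Theory.
Local Open Scope ring_scope.

(* In krawtchouk and kappa, d = r.+1.  The points 1, ..., d are encoded as
   0, ..., r in 'I_r.+1, so that the point 1 is ord0 and the points 2, ..., d
   are lift ord0 l for l : 'I_r.  The indices 0, ..., d-1 of the functions
   u^(j) and of the entries of n^+ are the elements of 'I_r.+1 themselves, so
   that 1, ..., d-1 are again lift ord0 l.  [u j i] is u^(j) at the point
   encoded by i.  A polynomial in {mpoly R[r]} has its variables 'X_l indexed
   accordingly: 'X_l is w_{l+1} in krawtchouk, and y_{l+2} when polynomials
   are evaluated at kappa. *)

Definition multinomial (R : fieldType) (d N : nat) (n : 'I_d -> nat) : R :=
  (N`!)%:R / \prod_j ((n j)`!)%:R.

Definition tail (T : Type) (r : nat) (n : 'I_r.+1 -> T) : 'I_r -> T :=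
  fun l => n (lift ord0 l).

Definition krawtchouk (R : fieldType) (r : nat) (u : 'I_r.+1 -> 'I_r.+1 -> R)
    (n : 'I_r -> nat) (x : 'I_r.+1 -> nat) : R :=
  (\prod_(j < r.+1)
     (1 + \sum_(l < r) u (lift ord0 l) j *: 'X_l : {mpoly R[r]}) ^+ x j)
    @_[multinom n l | l < r].

Definition kappa (R : fieldType) (r : nat) (u : 'I_r.+1 -> 'I_r.+1 -> R)
    (n : 'I_r.+1 -> nat) : 'I_r -> R :=
  fun l => \sum_(j < r.+1) u j (lift ord0 l) * (n j)%:R.

(* Main.v *)
(* Put F(G, n) = n_0! ... n_r! [w^n] G.  Multiplying G by the linear form L_i of
   the point i gives F(L_i G, n) = sum_j u^(j)_i n_j F(G, n - e_j), and
   kappa(n - e_j) = kappa(n) - u^(j).  By orthogonality every sum_j f_j n_j is an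
   affine function of kappa(n) once |n| is fixed, so if F(G, n) = P(kappa(n)) then
   F(L_l G, n) = kappa_l P(kappa(n)) + terms of degree at most deg P.  Starting
   from L_1^(x_1), for which F is the constant x_1!, and multiplying by the
   other factors one at a time gives the claim with c = x_1! / N!.  Taking L_1
   first matters: u^(j)_1 = 1, so multiplying by L_1 later would not raise the
   degree, and the leading coefficient would be harder to control. *)

Require Import Defs.
From mathcomp Require Import all_boot all_order all_algebra.
From mathcomp Require Import mpoly.
From mathcomp Require Import ring.
Set Implicit Arguments.
Unset Strict Implicit.
Unset Printing Implicit Defensive.
Import GRing.Theory Num.Theory.
Local Open Scope ring_scope.

(** * Size bounds and coefficients of multivariate polynomials *)

Lemma leq_msizeM (R : idomainType) (r : nat) (p q : {mpoly R[r]}) :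
  (msize (p * q) <= (msize p + msize q).-1)%N.
Proof.
have [->|p0] := eqVneq p 0; first by rewrite mul0r mmeasure0.
have [->|q0] := eqVneq q 0; first by rewrite mulr0 mmeasure0.
by rewrite msizeM.
Qed.

Lemma msizeD_leq (R : nzRingType) (r d : nat) (p q : {mpoly R[r]}) :
  (msize p <= d -> msize q <= d -> msize (p + q) <= d)%N.
Proof.
by move=> hp hq; rewrite (leq_trans (mmeasureD_le _ _ _)) // geq_max hp hq.
Qed.

Lemma msizeXUM_leq (R : idomainType) (r d : nat) (l : 'I_r) (q : {mpoly R[r]}) :
  (msize q <= d -> msize ('X_l * q) <= d.+1)%N.
Proof.
by move=> hq; rewrite (leq_trans (leq_msizeM _ _)) // msizeX mdeg1 ltnS.
Qed.

Lemma mcoeffXUM (R : comNzRingType) (r : nat) (l : 'I_r) (q : {mpoly R[r]})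
    (m : 'X_{1..r}) :
  ('X_l * q)@_m = if m l == 0%N then 0 else q@_(m - U_(l)).
Proof.
rewrite mulrC; case: eqP => [ml0|/eqP ml].
  apply/eqP; rewrite mcoeff_eq0 (perm_mem (msuppMX _ _)).
  by apply/mapP => -[m' _ e]; move: ml0; rewrite e mnmDE mnm1E eqxx.
by rewrite -{1}(submK (m := U_(l)) (m' := m)) ?lep1mP // addmC mcoeffMX.
Qed.

(* n_0 is present only in the factorials: G is dehomogenised at w_0 = 1. *)
Definition fact_mcoeff (R : nzRingType) (r : nat) (G : {mpoly R[r]})
    (n : 'I_r.+1 -> nat) : R :=
  (\prod_j (n j)`!)%:R * G@_[multinom tail n l | l < r].

(** For [n j = 0] truncation leaves [n] unchanged; the recursion weights such a term by [n j], so it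
    does no harm. *)
Definition decr (r : nat) (n : 'I_r -> nat) (j : 'I_r) : 'I_r -> nat :=
  fun i => (n i - (i == j))%N.

Lemma sum_decr (r : nat) (n : 'I_r -> nat) (j : 'I_r) :
  n j != 0%N -> (\sum_i n i)%N = (\sum_i decr n j i).+1.
Proof.
move=> nj; rewrite (bigD1 j) //= [in RHS](bigD1 j) //= /decr eqxx.
rewrite -addSn -subSn ?lt0n // subn1; congr addn.
by apply: eq_bigr => i /negbTE ->; rewrite subn0.
Qed.

Lemma prod_fact_decr (r : nat) (n : 'I_r -> nat) (j : 'I_r) :
  n j != 0%N -> (\prod_i (n i)`! = n j * \prod_i (decr n j i)`!)%N.
Proof.
move=> nj; rewrite (bigD1 j) //= [in RHS](bigD1 j) //= /decr eqxx.
rewrite mulnA subn1; congr muln.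
  by case: (n j) nj => // k _; rewrite factS.
by apply: eq_bigr => i /negbTE ->; rewrite subn0.
Qed.

Definition linear_factor (R : nzRingType) (r : nat) (c : 'I_r.+1 -> R) :
    {mpoly R[r]} :=
  1 + \sum_(l < r) c (lift ord0 l) *: 'X_l.

Lemma msize_linear_factor (R : nzRingType) (r : nat) (c : 'I_r.+1 -> R) :
  (msize (linear_factor c) <= 2)%N.
Proof.
apply: msizeD_leq; first by rewrite msize1.
rewrite (leq_trans (mmeasure_sum _ _ _ _)) //; apply/bigmax_leqP => l _.
by rewrite (leq_trans (msizeZ_le _ _)) // msizeX mdeg1.
Qed.

(** Each w_j in the factor lowers one exponent, and n_j! = n_j (n_j - 1)! supplies the weight. The
    size bound serves the case n_0 = 0: the contribution of the constant 1 must vanish, and it does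
    because the monomial then has degree |n|, above that of [G]. *)
Lemma fact_mcoeff_linear_factor (R : comNzRingType) (r : nat)
    (c : 'I_r.+1 -> R) (G : {mpoly R[r]}) (n : 'I_r.+1 -> nat) :
  c ord0 = 1 -> (msize G <= \sum_j n j)%N ->
  fact_mcoeff (linear_factor c * G) n =
  \sum_j c j * (n j)%:R * fact_mcoeff G (decr n j).
Proof.
move=> c0 hG; rewrite /fact_mcoeff /linear_factor mulrDl mul1r mcoeffD mulrDr.
rewrite [RHS]big_ord_recl; congr (_ + _).
  rewrite c0 mul1r mulrA -natrM; have [n0|n0] := eqVneq (n ord0) 0%N.
    rewrite n0 mul0n mul0r -[X in _ * X](_ : 0 = _) ?mulr0 //.
    apply/esym/eqP; rewrite mcoeff_eq0; apply: msize_mdeg_ge.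
    rewrite mdegE (leq_trans hG) // big_ord_recl n0 add0n.
    by apply: leq_sum => l _; rewrite mnmE.
  rewrite -prod_fact_decr //; congr (_ * G@_ _).
  by apply/mnmP => l; rewrite !mnmE /tail /decr subn0.
rewrite mulr_suml raddf_sum mulr_sumr; apply: eq_bigr => l _.
rewrite -scalerAl /= mcoeffZ mcoeffXUM mnmE {2}/tail.
have [nl|nl] := eqVneq (n (lift ord0 l)) 0%N.
  by rewrite nl !(mulr0, mul0r).
rewrite (prod_fact_decr nl) natrM.
have -> : [multinom tail (decr n (lift ord0 l)) l0 | l0 < r] =
   ([multinom tail n l0 | l0 < r] - U_(l))%MM.
  apply/mnmP => k; rewrite !mnmE /tail /decr (inj_eq lift_inj).
  by rewrite eq_sym.
by ring.
Qed.

Lemma kappa_decr (R : fieldType) (r : nat) (u : 'I_r.+1 -> 'I_r.+1 -> R)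
    (n : 'I_r.+1 -> nat) (j : 'I_r.+1) (l : 'I_r) :
  n j != 0%N -> kappa u (decr n j) l = kappa u n l - u j (lift ord0 l).
Proof.
move=> nj; rewrite /kappa (bigD1 j) //= [in RHS](bigD1 j) //= /decr eqxx.
rewrite natrB ?lt0n // mulrBr mulr1 addrAC; congr (_ + _ - _).
by apply: eq_bigr => i /negbTE ->; rewrite subn0.
Qed.

(** * Inverting the matrix of u by orthogonality *)

Definition separating (R : nzRingType) (r : nat) (u : 'I_r -> 'I_r -> R) :=
  forall f : 'I_r -> R, exists al : 'I_r -> R,
    forall j, f j = \sum_i u j i * al i.

(** Orthogonality reads U D_p U^T = D_a, so D_p U^T D_a^(-1) is a right inverse of U; the witness is
    its value at [f]. *)
Lemma orthogonal_separating (R : realFieldType) (r : nat) (p a : 'I_r -> R)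
    (u : 'I_r -> 'I_r -> R) :
  (forall l, 0 < a l) ->
  (forall l m, \sum_i u l i * u m i * p i = if l == m then a l else 0) ->
  separating u.
Proof.
move=> a_gt0 ortho f.
exists (fun i => p i * \sum_m u m i * (f m / a m)) => j.
under eq_bigr => i _ do rewrite mulrA mulr_sumr.
rewrite exchange_big /= (bigD1 j) //= [X in _ + X]big1 => [|m mj].
  under eq_bigr => i _ do rewrite mulrA (mulrAC _ (p i)).
  by rewrite -mulr_suml ortho eqxx addr0 mulrC divfK // lt0r_neq0.
under eq_bigr => i _ do rewrite mulrA (mulrAC _ (p i)).
by rewrite -mulr_suml ortho eq_sym (negbTE mj) mul0r.
Qed.

(** * Weighted differences under the shifts of kappa *)

Section Shift.
Variables (R : fieldType) (r : nat) (u : 'I_r.+1 -> 'I_r.+1 -> R) (N : nat).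
Hypothesis u1 : forall j, u j ord0 = 1.
Hypothesis u_sep : separating u.

(** In the expansion of [f] given by [u_sep], the point 1 contributes a multiple of |n| = N, because
    u^(j)_1 = 1, and the other points contribute multiples of the kappa_l. *)
Lemma kappa_affine (f : 'I_r.+1 -> R) :
  exists2 E : {mpoly R[r]}, (msize E <= 2)%N &
    forall n : 'I_r.+1 -> nat, (\sum_j n j)%N = N ->
      \sum_j f j * (n j)%:R = E.@[kappa u n].
Proof.
have [al fE] := u_sep f.
exists ((al ord0 * N%:R)%:MP + \sum_(l < r) al (lift ord0 l) *: 'X_l).
  apply: msizeD_leq; first by rewrite msizeC; case: eqP.
  rewrite (leq_trans (mmeasure_sum _ _ _ _)) //; apply/bigmax_leqP => l _.
  by rewrite (leq_trans (msizeZ_le _ _)) // msizeX mdeg1.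
move=> n nN; rewrite mevalD mevalC raddf_sum /=.
under eq_bigr => j _ do rewrite fE mulr_suml.
rewrite exchange_big big_ord_recl /=; congr (_ + _).
  rewrite -nN natr_sum mulr_sumr; apply: eq_bigr => j _.
  by rewrite u1 mul1r.
apply: eq_bigr => l _; rewrite mevalZ mevalXU mulr_sumr.
by apply: eq_bigr => j _; rewrite mulrAC mulrC.
Qed.

Definition shift_diff (P : {mpoly R[r]}) (n : 'I_r.+1 -> nat) (j : 'I_r.+1) :=
  P.@[fun l => kappa u n l - u j (lift ord0 l)] - P.@[kappa u n].

(** This controls the error of replacing P(kappa - u^(j)) by P(kappa) in the recursion. The weight
    [f] is arbitrary because the induction on monomials multiplies it by values of [u]. *)
Definition tame (d : nat) (P : {mpoly R[r]}) :=
  forall f : 'I_r.+1 -> R,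
  exists2 E : {mpoly R[r]}, (msize E <= d)%N &
    forall n : 'I_r.+1 -> nat, (\sum_j n j)%N = N ->
      \sum_j f j * (n j)%:R * shift_diff P n j = E.@[kappa u n].

Lemma tame0 d : tame d 0.
Proof.
move=> f; exists 0; first by rewrite mmeasure0.
move=> n _; rewrite meval0 big1 // => j _.
by rewrite /shift_diff !meval0 subr0 mulr0.
Qed.

Lemma tameD d P Q : tame d P -> tame d Q -> tame d (P + Q).
Proof.
move=> hP hQ f; have [E1 s1 h1] := hP f; have [E2 s2 h2] := hQ f.
exists (E1 + E2); first exact: msizeD_leq.
move=> n nN; rewrite mevalD -h1 // -h2 // -big_split; apply: eq_bigr => j _ /=.
by rewrite /shift_diff !mevalD; ring.
Qed.

Lemma tameZ d c P : tame d P -> tame d (c *: P).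
Proof.
move=> hP f; have [E s h] := hP f.
exists (c *: E); first exact: leq_trans (msizeZ_le _ _) s.
move=> n nN; rewrite mevalZ -h // mulr_sumr; apply: eq_bigr => j _ /=.
by rewrite /shift_diff !mevalZ; ring.
Qed.

(** Product rule: the difference of y_l P is kappa_l times that of P, minus v_j times that of P,
    minus v_j P(kappa). The three parts give [E1], [E2] and [P * E3], where the affine [E3] costs
    one degree. *)
Lemma tameXUM d l P : (msize P <= d)%N -> tame d P -> tame d.+1 ('X_l * P).
Proof.
move=> sP hP f; pose v j := u j (lift ord0 l).
have [E1 s1 h1] := hP f; have [E2 s2 h2] := hP (fun j => f j * v j).
have [E3 s3 h3] := kappa_affine (fun j => f j * v j).
exists ('X_l * E1 + (-1) *: (E2 + P * E3)).
  apply: msizeD_leq; first exact: msizeXUM_leq.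
  rewrite (leq_trans (msizeZ_le _ _)) //; apply: msizeD_leq.
    exact: leq_trans s2 _.
  rewrite (leq_trans (leq_msizeM _ _)) //.
  by rewrite -subn1 leq_subLR add1n -addn2 leq_add.
move=> n nN; rewrite mevalD mevalZ mevalD !mevalM mevalXU -h1 // -h2 // -h3 //.
rewrite !mulr_sumr -big_split mulr_sumr -big_split; apply: eq_bigr => j _ /=.
by rewrite /shift_diff /v !mevalM !mevalXU; ring.
Qed.

Lemma tame_mpolyX m : tame (mdeg m).+1 'X_[m].
Proof.
move e: (mdeg m) => k; elim: k m e => [|k IH] m e.
  move/eqP: e; rewrite mdeg_eq0 => /eqP -> f.
  exists 0; first by rewrite mmeasure0.
  move=> n _; rewrite meval0 big1 // => j _.
  by rewrite /shift_diff mpolyX0 !meval1 subrr mulr0.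
have [l ml] : exists l, m l != 0%N.
  apply/existsP; apply: contra_eqT e; rewrite negb_exists => /forallP m0.
  by rewrite mdegE big1 // => l _; apply/eqP; have := m0 l; rewrite negbK.
have mE : m = (U_(l) + (m - U_(l)))%MM by rewrite addmC submK // lep1mP.
have dm : mdeg (m - U_(l)) = k.
  by move: e; rewrite {1}mE mdegD mdeg1 add1n => -[].
rewrite mE mpolyXD; apply: tameXUM; first by rewrite msizeX dm.
exact: IH.
Qed.

(* Translating a polynomial changes it only in lower degree, and weighting
   by the n_j gives back that one degree. *)
Lemma tame_msize P : tame (msize P) P.
Proof.
rewrite {2}[P]mpolyE big_seq; elim/big_ind: _ => [||m mP].
- exact: tame0.
- exact: tameD.
apply: tameZ => f; have [E s h] := tame_mpolyX m f.
by exists E => //; apply: leq_trans s (msize_mdeg_lt mP).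
Qed.

End Shift.

(** * Multiplying in the linear factors one at a time *)

Section Representation.
Variables (R : fieldType) (r : nat) (u : 'I_r.+1 -> 'I_r.+1 -> R) (x0 : nat).
Hypothesis u0 : forall i, u ord0 i = 1.
Hypothesis u1 : forall j, u j ord0 = 1.
Hypothesis u_sep : separating u.

Local Notation factor i := (linear_factor (u^~ i)).

Lemma msize_factorM_leq d i (G : {mpoly R[r]}) :
  (msize G <= d -> msize (factor i * G) <= d.+1)%N.
Proof.
move=> sG; rewrite (leq_trans (leq_msizeM _ _)) //.
by rewrite -subn1 leq_subLR add1n -add2n leq_add ?msize_linear_factor.
Qed.

Lemma msize_factorX_leq i k : (msize (factor i ^+ k) <= k.+1)%N.
Proof.
elim: k => [|k IH]; first by rewrite expr0 msize1.
by rewrite exprS msize_factorM_leq.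
Qed.

(** The factor is 1 + w_1 + ... + w_r, so this is the multinomial theorem. *)
Lemma fact_mcoeff_factor0X (n : 'I_r.+1 -> nat) k :
  (\sum_j n j)%N = k -> fact_mcoeff (factor ord0 ^+ k) n = k`!%:R.
Proof.
elim: k n => [|k IH] n nk.
  have n0 j : n j = 0%N.
    by apply/eqP; rewrite -leqn0 -nk (bigD1 j) //= leq_addr.
  rewrite /fact_mcoeff expr0 mcoeff1 big1 ?mul1r => [|j _]; last by rewrite n0.
  rewrite (_ : [multinom _ | l < r] = 0%MM) ?eqxx //.
  by apply/mnmP => l; rewrite !mnmE /tail n0.
rewrite exprS fact_mcoeff_linear_factor // ?nk ?msize_factorX_leq //.
rewrite factS natrM -{1}nk natr_sum mulr_suml; apply: eq_bigr => j _.
rewrite u1 mul1r; have [->|nj] := eqVneq (n j) 0%N; first by rewrite !mul0r.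
by rewrite IH //; apply/succn_inj; rewrite -sum_decr.
Qed.

(** [G] stands for a product of [x0] factors of the point 1 and [k] others, [M] for the leading
    monomial. The bound on [G] is the one the recursion requires at the next total, x0 + k + 1. *)
Definition represents (k : nat) (M G : {mpoly R[r]}) :=
  [/\ (msize M <= k.+1)%N, (msize G <= (x0 + k).+1)%N &
  exists2 P : {mpoly R[r]}, (msize (P - x0`!%:R *: M) <= k)%N &
    forall n : 'I_r.+1 -> nat, (\sum_j n j)%N = (x0 + k)%N ->
      fact_mcoeff G n = P.@[kappa u n]].

Lemma represents0 : represents 0 1 (factor ord0 ^+ x0).
Proof.
split; rewrite ?msize1 ?addn0 ?msize_factorX_leq //.
exists (x0`!%:R *: 1); first by rewrite subrr mmeasure0.
by move=> n nx0; rewrite fact_mcoeff_factor0X // mevalZ meval1 mulr1.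
Qed.

Lemma represents_factorM l k M G :
  represents k M G ->
  represents k.+1 ('X_l * M) (factor (lift ord0 l) * G).
Proof.
move=> [sM sG [P sP hP]].
split; [exact: msizeXUM_leq | by rewrite addnS msize_factorM_leq |].
have sPk : (msize P <= k.+1)%N.
  rewrite -[P](subrK (x0`!%:R *: M)); apply: msizeD_leq; first exact: leqW.
  exact: leq_trans (msizeZ_le _ _) sM.
have [E sE hE] := tame_msize (x0 + k).+1 u1 u_sep P (u^~ (lift ord0 l)).
(* Summing u^(j)_l n_j P(kappa) gives the main term; [E] collects the differences of [P] and has no
   larger size than [P]. *)
exists ('X_l * P + E).
  rewrite addrAC; apply: msizeD_leq; last exact: leq_trans sPk.
  by rewrite scalerAr -mulrBr msizeXUM_leq.
move=> n; rewrite addnS => nk.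
rewrite fact_mcoeff_linear_factor ?nk // mevalD mevalM mevalXU -hE //.
rewrite {1}/kappa mulr_suml -big_split; apply: eq_bigr => j _ /=.
(* For n_j = 0 the total of [decr n j] is too large for [hP], but the weight vanishes. *)
have [->|nj] := eqVneq (n j) 0%N; first by rewrite !(mulr0, mul0r) addr0.
rewrite hP; last by apply/succn_inj; rewrite -sum_decr.
rewrite /shift_diff -mulrDr addrC subrK; congr (_ * _).
by apply: meval_eq => i; rewrite kappa_decr.
Qed.

Lemma represents_factorXM l i k M G :
  represents k M G ->
  represents (i + k) ('X_l ^+ i * M) (factor (lift ord0 l) ^+ i * G).
Proof.
move=> h; elim: i => [|i IH]; first by rewrite !expr0 !mul1r.
by rewrite !exprS -!mulrA; apply: represents_factorM.
Qed.

Lemma represents_prod (x : 'I_r -> nat) :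
  represents (\sum_(l < r) x l) (\prod_(l < r) 'X_l ^+ x l)
    ((\prod_(l < r) factor (lift ord0 l) ^+ x l) * factor ord0 ^+ x0).
Proof.
elim/big_rec3: _ => [|l G M k _ h]; first by rewrite mul1r; apply: represents0.
by rewrite -mulrA; apply: represents_factorXM.
Qed.

End Representation.

Theorem theorem5 (R : realFieldType) (N r : nat)
    (hN : (1 <= N)%N) (hd : (2 <= r.+1)%N)
    (p : 'I_r.+1 -> R) (hp : forall i, 0 < p i) (hp1 : \sum_i p i = 1)
    (u : 'I_r.+1 -> 'I_r.+1 -> R) (a : 'I_r.+1 -> R)
    (ha : forall l, 0 < a l)
    (hortho : forall l m,
      \sum_i u l i * u m i * p i = if l == m then a l else 0)
    (hu0 : forall i, u ord0 i = 1)
    (hu1 : forall j, u j ord0 = 1)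
    (x : 'I_r.+1 -> nat) (hx : (\sum_i x i)%N = N) :
  exists (P : {mpoly R[r]}) (c : R),
    [/\ c != 0,
        forall n : 'I_r.+1 -> nat, (\sum_j n j)%N = N ->
          (multinomial R N n)^-1 * krawtchouk u (tail n) x = P.@[kappa u n]
      & forall m : 'X_{1..r},
          m \in msupp (P - c *: \prod_(l < r) 'X_l ^+ (tail x l)) ->
          (mdeg m < \sum_(l < r) tail x l)%N].
Proof.
have u_sep := orthogonal_separating ha hortho.
have N0 : N`!%:R != 0 :> R by rewrite pnatr_eq0 -lt0n fact_gt0.
have x00 : (x ord0)`!%:R != 0 :> R by rewrite pnatr_eq0 -lt0n fact_gt0.
have [_ _ [P sP hP]] := represents_prod (x ord0) hu0 hu1 u_sep (tail x).
(* Dividing by the multinomial coefficient multiplies by all n_j! and divides by N!, which leaves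
   [fact_mcoeff] of the full product over N!. *)
exists (N`!%:R^-1 *: P), (N`!%:R^-1 * (x ord0)`!%:R); split.
- by rewrite mulf_neq0 ?invr_eq0.
- move=> n nN; rewrite mevalZ -hP; last by rewrite nN -hx big_ord_recl.
  rewrite /multinomial /krawtchouk /fact_mcoeff invf_div natr_prod big_ord_recl.
  by rewrite [X in _ = _ * (_ * X@__)]mulrC mulrA (mulrC _^-1).
- move=> m; rewrite -scalerA -scalerBr => mP.
  have := leq_trans (msize_mdeg_lt mP) (msizeZ_le _ _).
  by move/leq_trans; apply.
Qed.
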